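(* Let $A,B,C$ be real matrices of sizes $n\times n$, $n\times r$, $l\times n$ with $r>l$, $\operatorname{rank}C=l$, $(A,C)$ observable with observability index $\alpha$, and suppose $P(s)=\begin{bmatrix} sI_n-A & -B \\ C & O \end{bmatrix}$ has normal rank $n+l$. Let $\tilde B(s)=[O,\bar B_1]+[O,\bar B_2]s+\cdots+[O,\bar B_{\alpha-1}]s^{\alpha-2}+\bar B_\alpha s^{\alpha-1}$ be the $r\times l$ matrix polynomial obtained from the Yokoyama canonical form of $(A^T,C^T)$ as in the context. Then the system zeros of $\dot x=Ax+Bu$, $y=Cx$ coincide with the zeros of the polynomial $\bar\psi(s)$ that is the greatest common divisor of all the not identically zero polynomials of the form $s^{\,n-l\alpha}$ times an order-$l$ minor of $\tilde B(s)$.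
   Context: The observability index $\alpha$ of $(A,C)$ is the smallest integer with $\operatorname{rank}[C^T,A^TC^T,\dots,(A^T)^{\alpha-1}C^T]=\operatorname{rank}[C^T,\dots,(A^T)^{n-1}C^T]$. Integers $\bar l_1\le\cdots\le\bar l_\alpha=l$ are defined by $\bar l_\alpha=\operatorname{rank}C$ and $\bar l_{\alpha-k}=\operatorname{rank}[C^T,\dots,(A^T)^{k}C^T]-\operatorname{rank}[C^T,\dots,(A^T)^{k-1}C^T]$, $k=1,\dots,\alpha-1$; then $\bar l_1+\cdots+\bar l_\alpha=n$. Yokoyama canonical form of $(A^T,C^T)$: there are a nonsingular $n\times n$ matrix $N^*$ and an $l\times l$ permutation matrix $M^*$ such that $$N^*A^TN^{*-1}=\begin{bmatrix} O & E_{1,2} & O & \cdots & O \\ O & O & E_{2,3} & \cdots & O \\ \vdots & & & \ddots & \vdots \\ O & O & O & \cdots & E_{\alpha-1,\alpha} \\ F_{\alpha 1} & F_{\alpha 2} & F_{\alpha 3} & \cdots & F_{\alpha\alpha} \end{bmatrix},\qquad N^*C^TM^*=\begin{bmatrix} O \\ G_\alpha \end{bmatrix},$$ with block sizes $\bar l_1,\dots,\bar l_\alpha$, $E_{i,i+1}=[O,I_{\bar l_i}]$ of size $\bar l_i\times\bar l_{i+1}$, and $G_\alpha$ an $l\times l$ lower triangular matrix with unit diagonal. Fix such $N^*,M^*$ and partition $B^TN^{*-1}=[\bar B_1,\dots,\bar B_\alpha]$ with $\bar B_i$ of size $r\times\bar l_i$. $[O,\bar B_i]$ denotes $\bar B_i$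 padded on the left by zero columns to have $l$ columns. System zeros: among the minors of $P(s)$ formed by rows $1,\dots,n,n+i_1,\dots,n+i_k$ and columns $1,\dots,n,n+j_1,\dots,n+j_k$, take those of the largest order that are not identically zero; the system zeros are the zeros of their greatest common divisor. *)

(* Defs.v *)
From mathcomp Require Import all_boot all_order all_algebra.
From mathcomp Require Import reals complex.

Set Implicit Arguments.
Unset Strict Implicit.
Unset Printing Implicit Defensive.

Import GRing.Theory.
Local Open Scope ring_scope.

Section Observability.
Variables (F : fieldType) (n l : nat) (A : 'M[F]_n) (C : 'M[F]_(l, n)).

(* rank [C^T, A^T C^T, ..., (A^T)^(k-1) C^T] *)
Definition obsv_rank (k : nat) : nat :=
  \rank (\mxrow_(i < k) (A^T ^+ i *m C^T)).

Definition observable : Prop := obsv_rank n = n.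

Definition obsv_index (a : nat) : Prop :=
  obsv_rank a = obsv_rank n /\
  forall k, obsv_rank k = obsv_rank n -> (a <= k)%N.

(* obsv_incr k is \bar l_(a - k) *)
Definition obsv_incr (k : nat) : nat :=
  if k is 0 then \rank C else (obsv_rank k.+1 - obsv_rank k)%N.

(* Blocks are numbered from 0, so lbar a i is \bar l_(i + 1). *)
Definition lbar (a : nat) (i : 'I_a) : nat := obsv_incr (a - i.+1).

Lemma obsv_rankE k :
  obsv_rank k = \rank (\sum_(i < k) <<(A^T ^+ i *m C^T)^T>>)%MS.
Proof. by rewrite /obsv_rank -mxrank_tr tr_mxrow eqmx_col. Qed.

Lemma sum_obsv_incr k : (\sum_(i < k) obsv_incr i)%N = obsv_rank k.
Proof.
elim: k => [|k IHk]; first by rewrite big_ord0 obsv_rankE big_ord0 mxrank0.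
rewrite big_ord_recr {}IHk /=; case: k => [|k] /=.
  rewrite !obsv_rankE big_ord0 mxrank0 big_ord1 mxrank_gen mxrank_tr.
  by rewrite expr0 -[1]/(1%:M) mul1mx mxrank_tr.
rewrite subnKC // !obsv_rankE [X in (_ <= \rank X)%N]big_ord_recr /=.
exact/mxrankS/addsmxSl.
Qed.

Lemma sum_lbar a : observable -> obsv_index a -> n = (\sum_(i < a) lbar i)%N.
Proof.
move=> obsAC [rank_a _]; rewrite -[LHS]obsAC -rank_a -sum_obsv_incr.
by rewrite (reindex_inj rev_ord_inj).
Qed.

End Observability.

(* [O, X], the matrix X padded on the left by zero columns to p columns;
   meaningful only when m <= p. *)
Definition lpad (V : nmodType) (r m p : nat) (X : 'M[V]_(r, m)) : 'M[V]_(r, p) :=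
  conform_mx 0 (row_mx (0 : 'M_(r, p - m)) X).

Section Yokoyama.
Variables (F : fieldType) (n r l a : nat) (lb : 'I_a -> nat).
Variable en : n = (\sum_(i < a) lb i)%N.

(* The last block row F_(a, j) is arbitrary.  The last block G_a has size
   lb a x l, which is l x l in the intended use, hence the comparison of its
   indices as natural numbers. *)
Definition yokoyama_form (A : 'M[F]_n) (C : 'M[F]_(l, n))
    (N : 'M[F]_n) (M : 'M[F]_l) : Prop :=
  let NA := castmx (en, en) (N *m A^T *m invmx N) in
  let NC := castmx (en, erefl l) (N *m C^T *m M) in
  [/\ N \in unitmx, is_perm_mx M,
      forall i j : 'I_a, (i.+1 < a)%N ->
        submxblock NA i j = if j == i.+1 :> nat then lpad _ 1%:M else 0,
      forall i : 'I_a, (i.+1 < a)%N -> submxcol NC i = 0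
    & forall i : 'I_a, i.+1 = a ->
        is_trig_mx (submxcol NC i) /\
        forall (x : 'I_(lb i)) (y : 'I_l), x = y :> nat ->
          submxcol NC i x y = 1].

Definition Bbar (B : 'M[F]_(n, r)) (N : 'M[F]_n) (i : 'I_a) : 'M[F]_(r, lb i) :=
  submxrow (castmx (erefl r, en) (B^T *m invmx N)) i.

Definition Btilde (B : 'M[F]_(n, r)) (N : 'M[F]_n) : 'M[{poly F}]_(r, l) :=
  \sum_(i < a) 'X^i *: map_mx polyC (lpad l (Bbar B N i)).

End Yokoyama.

Definition increasing (k m : nat) (f : 'I_k -> 'I_m) : Prop :=
  forall i j : 'I_k, (i < j)%N -> (f i < f j)%N.

Definition is_minor (R : comPzRingType) (m p : nat) (X : 'M[R]_(m, p))
    (k : nat) (d : R) : Prop :=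
  exists (f : 'I_k -> 'I_m) (g : 'I_k -> 'I_p),
    [/\ increasing f, increasing g & d = \det (mxsub f g X)].

Definition is_gcd_of (F : fieldType) (S : {poly F} -> Prop) (d : {poly F}) : Prop :=
  (forall p, S p -> d %| p) /\
  (forall d', (forall p, S p -> d' %| p) -> d' %| d).

Section SystemZeros.
Variables (F : fieldType) (n r l : nat).
Variables (A : 'M[F]_n) (B : 'M[F]_(n, r)) (C : 'M[F]_(l, n)).

Definition sysmx : 'M[{poly F}]_(n + l, n + r) :=
  block_mx ('X%:M - map_mx polyC A) (- map_mx polyC B) (map_mx polyC C) 0.

Definition normal_rank (m p : nat) (X : 'M[{poly F}]_(m, p)) : nat :=
  \rank (map_mx (@FracField.tofrac _) X).

(* 1, ..., n, n + f_1, ..., n + f_k *)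
Definition border (k m : nat) (f : 'I_k -> 'I_m) (i : 'I_(n + k)) : 'I_(n + m) :=
  match split i with inl x => lshift m x | inr x => rshift n (f x) end.

Definition bordered_minor (k : nat) (d : {poly F}) : Prop :=
  exists (f : 'I_k -> 'I_l) (g : 'I_k -> 'I_r),
    [/\ increasing f, increasing g &
        d = \det (mxsub (border f) (border g) sysmx)].

Definition system_zero_minor (d : {poly F}) : Prop :=
  exists k, [/\ bordered_minor k d, d != 0 &
    forall k' d', bordered_minor k' d' -> d' != 0 -> (k' <= k)%N].

Definition system_zero_poly : {poly F} -> Prop := is_gcd_of system_zero_minor.

End SystemZeros.

(* The nonzero polynomials q = s^(n - l a) d with d an order-l minor of X; the
   exponent is nonpositive, so the equation is multiplied by s^(l a). *)
Definition shifted_minor (F : fieldType) (n r l a : nat)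
    (X : 'M[{poly F}]_(r, l)) (q : {poly F}) : Prop :=
  q != 0 /\ exists2 d, is_minor X l d & 'X^(l * a) * q = 'X^n * d.

(* Equality of the complex zeros, counted with multiplicity. *)
Definition same_zeros (R : realType) (p q : {poly R}) : Prop :=
  let toC := map_poly (real_complex R) in
  forall z : complex R,
    root (toC p) z = root (toC q) z /\ mup z (toC p) = mup z (toC q).

(* Main.v *)
Require Import Defs.
From mathcomp Require Import all_boot all_order all_algebra.
From mathcomp Require Import reals complex zify.

(* Let L = N A^T N^-1 and H = N C^T M.  Only the last block row of H is nonzero,
   and it is unitriangular, so column operations on the transposed and
   conjugated system matrix [[s - L, H], [- B^T N^-1, 0]] replace L by the
   nilpotent shift S obtained by erasing its last block row.  Let U(s) be the
   block column with blocks s^(i-1) [O, I].  Then (s - S) U = s^a J, where J is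
   the embedding of the last block, and B^T N^-1 U is the matrix B~ of the
   statement.  Eliminating with U gives, for the minor p_g of P(s) on all rows
   and on the columns 1, ..., n, n + g_1, ..., n + g_l,
     s^(l a) p_g det M = det (s - S) det B~_g = s^n det B~_g.
   The normal rank forces some p_g to be nonzero, so the minors defining the
   system zeros are the nonzero p_g, and both gcds agree up to a unit. *)

Set Implicit Arguments.
Unset Strict Implicit.
Unset Printing Implicit Defensive.

Import GRing.Theory.
Local Open Scope ring_scope.

(** * Strictly increasing index maps and minors of full order *)

Lemma increasing_inj k m (f : 'I_k -> 'I_m) : increasing f -> injective f.
Proof.
move=> incf i j eq_f; apply: val_inj; case: (ltngtP i j) => //.
  by move=> /incf; rewrite eq_f ltnn.
by move=> /incf; rewrite eq_f ltnn.
Qed.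

Lemma increasing_leq k m (f : 'I_k -> 'I_m) : increasing f -> (k <= m)%N.
Proof. by move=> /increasing_inj/leq_card; rewrite !card_ord. Qed.

Lemma increasing_geq k m (f : 'I_k -> 'I_m) (i : 'I_k) :
  increasing f -> (i <= f i)%N.
Proof.
move=> incf; case: i => i /=; elim: i => [//|i IHi] lt_ik.
apply: leq_ltn_trans (IHi (ltnW lt_ik)) _; exact: incf.
Qed.

(** [increasing_geq] bounds [f] from below; applied to [f] conjugated by order reversal, it also
    bounds [f] from above. *)
Lemma increasing_ord_id l (f : 'I_l -> 'I_l) : increasing f -> f =1 id.
Proof.
move=> incf i; apply/val_inj/eqP; rewrite eqn_leq (increasing_geq i incf) andbT.
pose h j := rev_ord (f (rev_ord j)).
have inch : increasing h.
  move=> x y lt_xy; have lt_rev: (rev_ord y < rev_ord x)%N.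
    by rewrite /=; have := ltn_ord y; lia.
  have := incf _ _ lt_rev; have := ltn_ord (f (rev_ord x)).
  by rewrite /h /=; lia.
have := increasing_geq (rev_ord i) inch; rewrite /h rev_ordK /=.
by rewrite leq_sub2lE.
Qed.

Lemma max_minorE (R : comNzRingType) r l (X : 'M[R]_(r, l)) d :
  is_minor X l d <->
  exists2 g : 'I_l -> 'I_r, increasing g & d = \det (rowsub g X).
Proof.
split=> [[g [f [incg incf ->]]]|[g incg ->]]; last by exists g, id; split.
by exists g => //; rewrite (mxsub_eq_rowsub _ (increasing_ord_id incf)).
Qed.

(** * Monotonicity of the block sizes *)

Section ObservabilityIncrements.
Variables (F : fieldType) (n l : nat) (A : 'M[F]_n) (C : 'M[F]_(l, n)).

(** Row space of the blocks C, C A, ..., C A^(k-1): the rank in [obsv_rank] becomes the dimension of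
    a subspace on which [A] acts from the right. *)
Let V k := (\sum_(i < k) <<(A^T ^+ i *m C^T)^T>>)%MS.

Let V_S k : (V k.+1 :=: V k + V 1 *m A ^+ k)%MS.
Proof.
rewrite /V big_ord_recr /= big_ord1; apply: adds_eqmx => //.
apply: eqmx_trans (genmxE _) (eqmx_sym (eqmx_trans (eqmxMr _ (genmxE _)) _)).
rewrite expr0 -[1]/(1%:M) mul1mx trmxK trmx_mul trmxK.
suff -> : (A^T ^+ k)^T = A ^+ k by [].
elim: k => [|k IHk]; first by rewrite !expr0 -[1]/(1%:M) trmx1.
by rewrite exprS exprSr -mulmxE trmx_mul trmxK IHk.
Qed.

(** Counterpart of [V_S] that splits off the first block instead of the last; it shows that [A] maps
    [V k] into [V k.+1]. *)
Let V_rec k : (V k.+1 :=: V 1 + V k *m A)%MS.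
Proof.
elim: k => [|k IHk].
  rewrite /V [X in (_ :=: _ + X *m _)%MS]big_ord0 mul0mx.
  exact/eqmx_sym/addsmx0.
apply: eqmx_trans (V_S k.+1) _; rewrite exprSr.
apply: eqmx_trans (adds_eqmx IHk (eqmx_refl _)) _.
rewrite -addsmxA; apply: adds_eqmx => //; rewrite mulmxA.
apply: eqmx_trans (eqmx_sym (addsmxMr _ _ _)) _.
exact/eqmxMr/eqmx_sym/V_S.
Qed.

Let V_subS k : (V k <= V k.+1)%MS.
Proof. by rewrite V_S addsmxSl. Qed.

(* V k.+2 is the sum of V k.+1 and its image under A, and the intersection of
   these two contains the image of V k. *)
Lemma obsv_rank_concave k :
  (obsv_rank A C k.+2 + obsv_rank A C k <= (obsv_rank A C k.+1).*2)%N.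
Proof.
rewrite !obsv_rankE -/(V _) -/(V k) -/(V k.+1) -addnn.
have V2 : (V k.+2 :=: V k.+1 + V k.+1 *m A)%MS.
  apply/eqmxP/andP; split.
    by rewrite V_rec addsmxS // (V_rec k) addsmxSl.
  by rewrite addsmx_sub V_subS V_rec addsmxSr.
have capA : (V k *m A <= V k.+1 :&: V k.+1 *m A)%MS.
  by rewrite sub_capmx submxMr // V_rec addsmxSr.
have cap_ker : (\rank (V k :&: kermx A) <= \rank (V k.+1 :&: kermx A))%N.
  by apply/mxrankS/capmxS.
have := mxrankS capA; have := mxrank_sum_cap (V k.+1) (V k.+1 *m A).
have := mxrank_mul_ker (V k) A; have := mxrank_mul_ker (V k.+1) A.
have -> : \rank (V k.+2) = \rank (V k.+1 + V k.+1 *m A)%MS by rewrite V2.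
lia.
Qed.

(** Expanding the ranks as partial sums of increments turns concavity into a linear inequality, with
    k = 0 covered as well. *)
Lemma leq_obsv_incr k : (obsv_incr A C k.+1 <= obsv_incr A C k)%N.
Proof.
have := obsv_rank_concave k; rewrite -!sum_obsv_incr !big_ord_recr /=.
by set s := (\sum_(i < k) _)%N; lia.
Qed.

Lemma leq_lbar a (i j : 'I_a) : (i <= j)%N -> (lbar A C i <= lbar A C j)%N.
Proof.
move=> le_ij; rewrite /lbar.
have: (a - j.+1 <= a - i.+1)%N by lia.
elim: (a - i.+1)%N => [|k IHk]; first by rewrite leqn0 => /eqP ->.
rewrite leq_eqVlt => /predU1P[-> //|/IHk le_k].
exact: leq_trans (leq_obsv_incr k) le_k.
Qed.

Lemma lbar_last a (i : 'I_a) : i.+1 = a -> lbar A C i = \rank C.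
Proof. by rewrite /lbar => ->; rewrite subnn. Qed.

End ObservabilityIncrements.

(** * Selection of rows that give an invertible submatrix *)

Section MaximalMinor.
Variables (K : fieldType) (n r l : nat).

(** [fullrankfun] yields independent rows in no particular order; enumerating its image increasingly
    keeps the same rows, hence their span. *)
Lemma increasing_unit_rowsub (W : 'M[K]_(r, l)) :
  row_full W -> exists2 g : 'I_l -> 'I_r, increasing g & rowsub g W \in unitmx.
Proof.
move=> fullW; pose f := fullrankfun fullW; pose S := [set f i | i : 'I_l].
have cardS : #|S| = l.
  by rewrite card_imset ?card_ord //; apply: fullrankfun_inj.
pose g i := Order.enum_val (cast_ord (esym cardS) i).
exists g.
  move=> i j; rewrite !ltnNge -[(g j <= g i)%N]/(g j <= g i)%O.
  by rewrite (Order.le_enum_val (@Order.TotalTheory.le_total _ _)).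
rewrite -row_full_unit -sub1mx.
have := fullrowsub_full fullW; rewrite -sub1mx => /submx_trans; apply.
apply/row_subP => i; have Sfi : f i \in S by apply: imset_f.
pose j := cast_ord cardS (Order.enum_rank_in Sfi (f i)).
have gj : g j = f i by rewrite /g cast_ordK Order.enum_rankK_in.
by rewrite row_rowsub -gj -row_rowsub row_sub.
Qed.

Lemma block_schur (Q : 'M[K]_n) (C : 'M_(n, l)) m
    (B : 'M_(m, n)) (D : 'M_(m, l)) :
  Q \in unitmx ->
  block_mx Q C B D = block_mx 1%:M 0 (B *m invmx Q) 1%:M
                     *m block_mx Q C 0 (D - B *m invmx Q *m C).
Proof.
move=> Qunit; rewrite mulmx_block !mul1mx !mul0mx !addr0 mulmxKV //.
by rewrite addrC subrK.
Qed.

(** After elimination with [Q], selecting lower rows amounts to selecting rows of the Schur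
    complement [W], which inherits full column rank. *)
Lemma increasing_unit_block (Q : 'M[K]_n) C (B : 'M_(r, n)) (D : 'M_(r, l)) :
    Q \in unitmx -> row_full (block_mx Q C B D) ->
  exists2 g : 'I_l -> 'I_r, increasing g &
    block_mx Q C (rowsub g B) (rowsub g D) \in unitmx.
Proof.
move=> Qunit; pose W := D - B *m invmx Q *m C; rewrite block_schur // -/W.
move=> /eqP full; have fullW : row_full W.
  rewrite /row_full eqn_leq rank_leq_col -(leq_add2l n) -[X in (X <= _)%N]full.
  apply: leq_trans (mxrankM_maxr _ _) _.
  rewrite block_mxEv -addsmxE; apply: leq_trans (mxrank_adds_leqif _ _) _.
  by rewrite rank_row_0mx leq_add2r rank_leq_row.
have [g incg unitg] := increasing_unit_rowsub fullW; exists g => //.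
rewrite block_schur // unitmx_mul !unitmxE det_lblock det_ublock !det1 mulr1.
rewrite unitr1 unitrM -!unitmxE Qunit /=.
suff <- : rowsub g W = rowsub g D - rowsub g B *m invmx Q *m C by [].
by rewrite !mul_rowsub_mx; apply/matrixP=> i j; rewrite !mxE.
Qed.

End MaximalMinor.

(** * Greatest common divisors up to units, and their zeros *)

Lemma is_gcd_of_eqp (F : fieldType) (S1 S2 : {poly F} -> Prop) (c : F)
    (p q : {poly F}) :
    c != 0 -> (forall u, S1 u <-> S2 (c *: u)) ->
  is_gcd_of S1 p -> is_gcd_of S2 q -> p %= q.
Proof.
move=> nz_c S12 [p_dvd p_max] [q_dvd q_max]; apply/andP; split.
  apply: q_max => u S2u; rewrite -(dvdpZr _ _ (invr_neq0 nz_c)).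
  by apply: p_dvd; rewrite S12 scalerA divff // scale1r.
by apply: p_max => u /S12/q_dvd; rewrite dvdpZr.
Qed.

Lemma eqp_same_zeros (R : realType) (p q : {poly R}) : p %= q -> same_zeros p q.
Proof.
move=> /eqpP[[c d] /= /andP[nz_c nz_d] eq_cd]; rewrite /same_zeros /=.
have toCZ e (u : {poly R}) :
    map_poly (real_complex R) (e *: u)
    = (e%:C)%C *: map_poly (real_complex R) u.
  exact: map_polyZ.
have nzC e : e != 0 -> (e%:C)%C != 0 :> complex R by rewrite fmorph_eq0.
move=> z; have := congr1 (map_poly (real_complex R)) eq_cd; rewrite !toCZ.
set P := map_poly _ p; set Q := map_poly _ q => eqPQ.
have eqpPQ : P %= Q by apply/eqpP; exists (c%:C, d%:C)%C; rewrite //= !nzC.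
split; first exact: eqp_root.
(* Multiplicities are compared by divisibility below, which requires nonzero polynomials. *)
have [Q0|nzQ] := eqVneq Q 0.
  by move: eqpPQ; rewrite Q0 eqp0 => /eqP ->.
have nzP : P != 0 by apply: contraNneq nzQ => P0; rewrite -eqp0 eqp_sym -P0.
have mup_le u v : u != 0 -> v != 0 -> u %= v -> (mup z u <= mup z v)%N.
  by move=> nzu nzv eq_uv; rewrite mup_geq // -(eqp_dvdr _ eq_uv) -mup_geq.
by apply/eqP; rewrite eqn_leq !mup_le // eqp_sym.
Qed.

(** * Algebra of the blocks [O, I] *)

Section Padding.
Variable R : pzSemiRingType.

Lemma lpad_castmx (V : nmodType) r m p (le_mp : (m <= p)%N) (X : 'M[V]_(r, m)) :
  lpad p X = castmx (erefl r, subnK le_mp) (row_mx 0 X).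
Proof.
by rewrite /lpad -(conform_castmx (erefl r, subnK le_mp)) conform_mx_id.
Qed.

Lemma lpad1E m p (i : 'I_m) (j : 'I_p) : (m <= p)%N ->
  lpad p (1%:M : 'M[R]_m) i j = (j == (i + (p - m))%N :> nat)%:R.
Proof.
move=> le_mp; rewrite (lpad_castmx le_mp) castmxE /= cast_ord_id mxE.
case: splitP => k /= ->; rewrite mxE.
  by case: eqP => // eq_k; have := ltn_ord k; rewrite eq_k; lia.
by rewrite -val_eqE /= addnC eqn_add2r eq_sym.
Qed.

Lemma lpad_mul r m p (X : 'M[R]_(r, m)) : (m <= p)%N ->
  lpad p X = X *m lpad p 1%:M.
Proof.
move=> le_mp; rewrite !(lpad_castmx le_mp).
move: (p - m)%N (subnK le_mp) => k eq_p; case: p / eq_p {le_mp}.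
by rewrite !castmx_id mul_mx_row mulmx0 mulmx1.
Qed.

Lemma lpad_mul_lpad m p q : (m <= p)%N -> (p <= q)%N ->
  lpad p 1%:M *m lpad q 1%:M = lpad q 1%:M :> 'M[R]_(m, q).
Proof.
move=> le_mp le_pq; have le_mq := leq_trans le_mp le_pq.
apply/matrixP => i j; rewrite !mxE lpad1E //.
have lt_ip : (i + (p - m) < p)%N by have := ltn_ord i; lia.
rewrite (bigD1 (Ordinal lt_ip)) //= big1 ?addr0 => [|k ne_k].
  by rewrite !lpad1E //= eqxx mul1r; congr (_ == _)%:R; lia.
by rewrite lpad1E // -[_ == _ :> nat]/(k == Ordinal lt_ip) (negPf ne_k) mul0r.
Qed.

Lemma lpad_mul_tr m p : (m <= p)%N ->
  lpad p 1%:M *m (lpad p 1%:M)^T = 1%:M :> 'M[R]_m.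
Proof.
move=> le_mp; apply/matrixP => i j; rewrite !mxE.
have lt_ip : (i + (p - m) < p)%N by have := ltn_ord i; lia.
rewrite (bigD1 (Ordinal lt_ip)) //= big1 ?addr0 => [|k ne_k].
  by rewrite mxE !lpad1E //= eqxx mul1r eqn_add2r.
by rewrite lpad1E // -[_ == _ :> nat]/(k == Ordinal lt_ip) (negPf ne_k) mul0r.
Qed.

(** For equal sizes [O, I] is the identity up to a cast; [m] and [p] stay distinct because the last
    block size equals [l] only propositionally. *)
Lemma lpad_tr_mul m p r (X : 'M[R]_(m, r)) (eq_pm : p = m) i j :
  ((lpad p 1%:M)^T *m X) i j = X (cast_ord eq_pm i) j.
Proof.
have le_mp : (m <= p)%N by rewrite eq_pm.
have pm0 : (p - m = 0)%N by rewrite eq_pm subnn.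
rewrite mxE (bigD1 (cast_ord eq_pm i)) //= big1 ?addr0 => [|k ne_k].
  by rewrite mxE lpad1E //= pm0 addn0 eqxx mul1r.
rewrite mxE lpad1E //= pm0 addn0 eq_sym.
by rewrite -[_ == _ :> nat]/(k == cast_ord eq_pm i) (negPf ne_k) mul0r.
Qed.

End Padding.

(** * The nilpotent block shift and the determinant identity *)

Section ShiftForm.
Variables (R : comNzRingType) (a l : nat) (lb : 'I_a -> nat).
Hypothesis le_lb : forall i j : 'I_a, (i <= j)%N -> (lb i <= lb j)%N.
Hypothesis lb_last : forall i : 'I_a, i.+1 = a -> lb i = l.

Local Notation n := (\sum_(i < a) lb i)%N.

(** The shift S; the test on [j] fails throughout the last block row, which is therefore zero. *)
Definition shift_mx : 'M[R]_n :=
  \mxblock_(i < a, j < a)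
    (if j == i.+1 :> nat then lpad (lb j) (1%:M : 'M_(lb i)) else 0).

(** The embedding J; [lpad] gives the last block [l] columns although [lb i] is not convertible to
    [l]. *)
Definition last_mx : 'M[R]_(n, l) :=
  \mxcol_(i < a) (if i.+1 == a then lpad l (1%:M : 'M_(lb i)) else 0).

(** The block column U at [s]; blocks are numbered from 0, so the exponent is [i]. *)
Definition power_mx (s : R) : 'M[R]_(n, l) :=
  \mxcol_(i < a) (s ^+ i *: lpad l (1%:M : 'M_(lb i))).

Lemma lb_leq i : (lb i <= l)%N.
Proof.
have lt_a : (a.-1 < a)%N by have := ltn_ord i; lia.
rewrite -(lb_last (i := Ordinal lt_a)); last by rewrite /= prednK //; lia.
by apply: le_lb => /=; have := ltn_ord i; lia.
Qed.

(** Block i of both s U and S U is s^(i+1) [O, I], by [lpad_mul_lpad], except in the last block row,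
    where S vanishes and s^a [O, I] is left. *)
Lemma shift_mx_power s :
  (s%:M - shift_mx) *m power_mx s = s ^+ a *: last_mx.
Proof.
rewrite mulmxBl -scalar_mxC -mul_mx_scalar /power_mx /last_mx.
rewrite mul_mxblock_mxrow !mxcol_mul -mxcolB; apply: eq_mxcol => i.
rewrite !mul_mx_scalar scalerA -exprS.
have [lt_ia|le_ai] := ltnP i.+1 a.
  rewrite (bigD1 (Ordinal lt_ia)) //= eqxx big1 => [|j ne_j].
    rewrite addr0 -scalemxAr lpad_mul_lpad ?lb_leq ?le_lb //= subrr.
    by rewrite ltn_eqF // scaler0.
  by rewrite -[_ == _ :> nat]/(j == Ordinal lt_ia) (negPf ne_j) mul0mx.
have eq_ia : i.+1 = a by apply/eqP; rewrite eqn_leq ltn_ord.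
rewrite big1 => [|j _]; first by rewrite subr0 eq_ia eqxx.
by case: eqP => [eq_j|_]; [have := ltn_ord j; lia | rewrite mul0mx].
Qed.

(** Nonzero blocks lie strictly above the block diagonal, and the block number is monotone in the
    index. *)
Lemma shift_mx_upper (i j : 'I_n) : (j <= i)%N -> shift_mx i j = 0.
Proof.
move=> le_ji; rewrite mxE.
have le_sig: (tagnat.sig1 j <= tagnat.sig1 i)%N by apply: tagnat.le_sig1.
by case: eqP => [eq_ji|_]; [lia | rewrite mxE].
Qed.

Lemma det_shift_mx s : \det (s%:M - shift_mx) = s ^+ n.
Proof.
move: shift_mx shift_mx_upper => S S_upper.
rewrite -det_tr det_trig; last first.
  apply/is_trig_mxP => i j lt_ij; rewrite !mxE S_upper ?(ltnW lt_ij) //.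
  by rewrite -val_eqE /= gtn_eqF // subr0.
rewrite (eq_bigr (fun=> s)) ?prodr_const ?card_ord // => i _.
by rewrite !mxE eqxx S_upper // subr0.
Qed.

Lemma tr_last_mx_mul m (X : 'M[R]_(n, m)) (i : 'I_a) : i.+1 = a ->
  last_mx^T *m X = (lpad l (1%:M : 'M_(lb i)))^T *m submxcol X i.
Proof.
move=> eq_ia; rewrite -{1}(submxcolK X) tr_mxcol mul_mxrow_mxcol.
rewrite (bigD1 i) //= {1}eq_ia eqxx big1 ?addr0 // => j ne_j.
case: eqP => [eq_ja|]; last by rewrite trmx0 mul0mx.
by case/eqP: ne_j; apply/val_inj/succn_inj; rewrite eq_ia.
Qed.

(** J J^T is the projection onto the last block, since [O, I] [O, I]^T = I. *)
Lemma submxcol_last_mx_mul m (X : 'M[R]_(n, m)) (i : 'I_a) :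
  submxcol (last_mx *m (last_mx^T *m X)) i =
    if i.+1 == a then submxcol X i else 0.
Proof.
rewrite -submxcol_mul mxcolK; case: eqP => [eq_ia|_]; last by rewrite mul0mx.
by rewrite (tr_last_mx_mul _ eq_ia) mulmxA lpad_mul_tr ?lb_leq // mul1mx.
Qed.

Lemma last_mx_mulK m (X : 'M[R]_(n, m)) :
    (forall i : 'I_a, (i.+1 < a)%N -> submxcol X i = 0) ->
  last_mx *m (last_mx^T *m X) = X.
Proof.
move=> X0; apply/mxcolP => i; rewrite submxcol_last_mx_mul.
case: eqP => // /eqP ne_ia; rewrite X0 // ltn_neqAle ne_ia; exact: ltn_ord.
Qed.

Lemma last_mx_mul_shift (L : 'M[R]_n) :
    (forall i j : 'I_a, (i.+1 < a)%N ->
       submxblock L i j = if j == i.+1 :> nat then lpad _ 1%:M else 0) ->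
  L - last_mx *m (last_mx^T *m L) = shift_mx.
Proof.
move=> Lup; apply/mxblockP => i j; rewrite mxblockK submxblockB.
rewrite [submxblock (_ *m _) i j]submxblockEv submxcol_last_mx_mul.
case: eqP => [eq_ia|/eqP ne_ia].
  rewrite -submxblockEv subrr; case: eqP => // eq_j.
  by have := ltn_ord j; lia.
by rewrite submxrow0 subr0 Lup // ltn_neqAle ne_ia ltn_ord.
Qed.

(** Once G is split off on the right, the two clearing factors have determinants 1 and s^(l a). The
    power stays on the left because [s] need not be invertible. *)
Lemma det_companion_block (s : R) (L : 'M[R]_n) (G : 'M[R]_l)
    (B : 'M[R]_(l, n)) :
    (forall i j : 'I_a, (i.+1 < a)%N ->
       submxblock L i j = if j == i.+1 :> nat then lpad _ 1%:M else 0) ->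
  s ^+ (l * a) * \det (block_mx (s%:M - L) (last_mx *m G) (- B) 0)
    = s ^+ n * \det (B *m power_mx s) * \det G.
Proof.
move=> Lup; pose Y := last_mx^T *m L.
have -> : block_mx (s%:M - L) (last_mx *m G) (- B) 0
    = block_mx (s%:M - L) last_mx (- B) 0 *m block_mx 1%:M 0 0 G.
  by rewrite mulmx_block !mulmx0 !mul0mx !mulmx1 !addr0 !add0r.
have eqL : s%:M - L + last_mx *m Y = s%:M - shift_mx.
  by rewrite -(last_mx_mul_shift Lup) opprB addrA addrAC.
(* The first factor uses the columns of last_mx to clear the last block row
   of L, the second one then clears last_mx by shift_mx_power. *)
have: block_mx (s%:M - L) last_mx (- B) 0 *m block_mx 1%:M 0 Y 1%:M
        *m block_mx 1%:M (- power_mx s) 0 (s ^+ a)%:M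
    = block_mx (s%:M - shift_mx) 0 (- B) (B *m power_mx s).
  rewrite !mulmx_block !mulmx0 !mul0mx !mulmx1 !addr0 add0r eqL.
  rewrite !mulmxN shift_mx_power mul_mx_scalar addNr mulNmx opprK.
  by rewrite mul0mx addr0.
move/(congr1 determinant); rewrite !det_mulmx !det_lblock !det_ublock.
rewrite !det1 !det_scalar det_shift_mx -exprM !mul1r mulr1 => <-.
by rewrite mulrA (mulnC a) [s ^+ _ * _]mulrC.
Qed.

End ShiftForm.

(** * Bordered minors of the system matrix *)

Section BorderedMinors.
Variables (F : fieldType) (n r l : nat).
Variables (A : 'M[F]_n) (B : 'M[F]_(n, r)) (C : 'M[F]_(l, n)).

Lemma mxsub_border (g : 'I_l -> 'I_r) :
  mxsub (border id) (border g) (sysmx A B C)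
  = block_mx ('X%:M - map_mx polyC A) (- map_mx polyC (colsub g B))
             (map_mx polyC C) 0.
Proof.
apply/matrixP => i j; rewrite mxE /border /sysmx.
case: (split_ordP i) => {}i ->; case: (split_ordP j) => {}j ->.
- by rewrite !block_mxEul.
- by rewrite !block_mxEur !mxE.
- by rewrite !block_mxEdl.
- by rewrite !block_mxEdr !mxE.
Qed.

Lemma bordered_minor_max d : bordered_minor A B C l d <->
  exists2 g : 'I_l -> 'I_r, increasing g &
    d = \det (mxsub (border id) (border g) (sysmx A B C)).
Proof.
split=> [[f [g [incf incg ->]]]|[g incg ->]]; last by exists id, g; split.
exists g => //; congr (\det _); apply: eq_mxsub => // i.
by rewrite /border; case: split => // k; rewrite increasing_ord_id.
Qed.

(** Over the fraction field s I - A is invertible, its determinant being a monic characteristic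
    polynomial, so [increasing_unit_block] applies to the transpose of P(s) up to the sign
    conventions kept in the blocks. *)
Lemma exists_bordered_minor_max :
    normal_rank (sysmx A B C) = (n + l)%N ->
  exists2 d, bordered_minor A B C l d & d != 0.
Proof.
move=> nrank; pose tof := @FracField.tofrac {poly F}.
pose Q := map_mx tof ('X%:M - map_mx polyC A)^T.
have unitQ : Q \in unitmx.
  rewrite unitmxE /Q det_map_mx det_tr unitfE tofrac_eq0.
  exact/monic_neq0/char_poly_monic.
have full : row_full (block_mx Q (map_mx tof (map_mx polyC C)^T)
    (map_mx tof (- map_mx polyC B)^T) (0 : 'M_(r, l))).
  rewrite /row_full -[X in _ == X]nrank /normal_rank -mxrank_tr.
  rewrite /sysmx map_block_mx tr_block_mx; apply/eqP.
  by congr (\rank (block_mx _ _ _ _)); apply/matrixP => i j;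
    rewrite !mxE ?raddf0.
have [g incg unit_g] := increasing_unit_block unitQ full.
exists (\det (mxsub (border id) (border g) (sysmx A B C))).
  by apply/bordered_minor_max; exists g.
rewrite -tofrac_eq0 -det_map_mx mxsub_border map_block_mx.
move: unit_g; rewrite unitmxE unitfE -det_tr tr_block_mx => nz_det.
apply: etrans nz_det.
by congr (~~ (\det (block_mx _ _ _ _) == 0)); apply/matrixP => i j;
  rewrite !mxE ?raddf0.
Qed.

(** Transposing and multiplying by diag(N, I) and diag(N^-1, M) costs only the factor det M. *)
Lemma det_bordered_conj (N : 'M[F]_n) (M : 'M[F]_l) (g : 'I_l -> 'I_r) :
    N \in unitmx ->
  \det (mxsub (border id) (border g) (sysmx A B C)) * (\det M)%:P
  = \det (block_mx ('X%:M - map_mx polyC (N *m A^T *m invmx N))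
                   (map_mx polyC (N *m C^T *m M))
                   (- map_mx polyC (rowsub g (B^T *m invmx N))) 0).
Proof.
move=> unitN; rewrite mxsub_border -det_tr tr_block_mx.
pose Np := map_mx polyC N; pose Ni := map_mx polyC (invmx N).
have NNi : Np *m Ni = 1%:M by rewrite -map_mxM mulmxV // map_mx1.
have -> : block_mx ('X%:M - map_mx polyC (N *m A^T *m invmx N))
    (map_mx polyC (N *m C^T *m M))
    (- map_mx polyC (rowsub g (B^T *m invmx N))) 0
  = block_mx Np 0 0 1%:M *m
    block_mx ('X%:M - map_mx polyC A)^T (map_mx polyC C)^T
             (- map_mx polyC (colsub g B))^T 0^T *m
    block_mx Ni 0 0 (map_mx polyC M).
  rewrite !mulmx_block !mulmx0 !mul0mx !mul1mx !addr0 !add0r.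
  congr block_mx.
  - rewrite linearB /= tr_scalar_mx mulmxBr mulmxBl scalar_mxC.
    by rewrite -(mulmxA _ Np) NNi mulmx1 !map_mxM map_trmx.
  - by rewrite !map_mxM map_trmx.
  - by rewrite linearN /= mulNmx map_trmx trmx_mxsub -map_mxM mul_rowsub_mx.
  - by rewrite trmx0 mul0mx.
have detN : \det Np * \det Ni = 1 by rewrite -det_mulmx NNi det1.
rewrite !det_mulmx !det_ublock det1 mulr1 [\det Np * _]mulrC -mulrA.
rewrite [\det Np * _]mulrA detN mul1r.
by rewrite (det_map_mx (polyC : {rmorphism F -> {poly F}})).
Qed.

(** A bordered minor selects at most the [l] rows of C, and the normal rank supplies a nonzero one
    with all of them, so the largest [k] is [l]. *)
Lemma system_zero_minorE d :
    normal_rank (sysmx A B C) = (n + l)%N ->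
  system_zero_minor A B C d <-> bordered_minor A B C l d /\ d != 0.
Proof.
move=> nrank; have [d0 minor_d0 nz_d0] := exists_bordered_minor_max nrank.
have le_l k d1 : bordered_minor A B C k d1 -> (k <= l)%N.
  by case=> f [g [incf _ _]]; apply: increasing_leq incf.
split=> [[k [minor_d nz_d k_max]]|[minor_d nz_d]].
  have eq_kl : k = l.
    by apply/eqP; rewrite eqn_leq (le_l _ _ minor_d) (k_max _ _ minor_d0).
  by rewrite eq_kl in minor_d.
by exists l; split=> // k d1 /le_l.
Qed.

End BorderedMinors.

(** * From the canonical form to the minors of B~ *)

Lemma map_lpad1 (F : fieldType) m p :
  map_mx polyC (lpad p (1%:M : 'M[F]_m)) = lpad p 1%:M.
Proof. by rewrite /lpad map_conform_mx map_row_mx !map_mx0 map_mx1. Qed.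

Section Yokoyama.
Variables (F : fieldType) (n r l a : nat) (lb : 'I_a -> nat).
Hypothesis le_lb : forall i j : 'I_a, (i <= j)%N -> (lb i <= lb j)%N.
Hypothesis lb_last : forall i : 'I_a, i.+1 = a -> lb i = l.
Hypothesis le_ln : (l <= n)%N.

Lemma yokoyama_minor (en : n = (\sum_(i < a) lb i)%N)
    (A : 'M[F]_n) (B : 'M[F]_(n, r)) (C : 'M[F]_(l, n)) (N : 'M[F]_n)
    (M : 'M[F]_l) (g : 'I_l -> 'I_r) :
    yokoyama_form en A C N M ->
  'X^(l * a) * (\det (mxsub (border id) (border g) (sysmx A B C)) * (\det M)%:P)
    = 'X^n * \det (rowsub g (Btilde l en B N)).
Proof.
(* Replacing [n] by the sum of the block sizes makes the casts of the canonical form trivial. *)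
case=> unitN _; subst n; rewrite !castmx_id.
set L := N *m A^T *m invmx N; set H := N *m C^T *m M => Lup H0 Hlast.
rewrite (det_bordered_conj _ _ _ _ _ unitN) -/L -/H.
pose J := last_mx {poly F} l lb; pose Hp := map_mx polyC H.
have eqH : J *m (J^T *m Hp) = Hp.
  apply: last_mx_mulK => // i lt_ia.
  by rewrite /Hp /submxcol -map_mxsub -/(submxcol H i) H0 // map_mx0.
have detG : \det (J^T *m Hp) = 1.
  (* Without blocks n = 0, hence l = 0 and the determinant is that of an empty matrix. *)
  have [a0|a_gt0] := posnP a.
    have l0 : l = 0%N.
      apply/eqP; rewrite -leqn0; apply: leq_trans le_ln _.
      by rewrite big1 // => i; have := ltn_ord i; rewrite {2}a0.
    by move: (J^T *m Hp); rewrite l0 => G; rewrite det_mx00.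
  have lt_a : (a.-1 < a)%N by rewrite prednK.
  pose i := Ordinal lt_a; have eq_ia : i.+1 = a by rewrite /= prednK.
  have [trigH diagH] := Hlast i eq_ia; have eq_l := esym (lb_last eq_ia).
  have GE x y : (J^T *m Hp) x y = (submxcol H i (cast_ord eq_l x) y)%:P.
    rewrite (tr_last_mx_mul _ _ eq_ia) lpad_tr_mul.
    by rewrite !mxE.
  rewrite det_trig; last first.
    apply/is_trig_mxP => x y lt_xy; rewrite GE.
    by rewrite (is_trig_mxP trigH).
  by rewrite big1 // => x _; rewrite GE diagH.
(* Block by block, B~ is B^T N^-1 times U at ['X]. *)
have BtE : rowsub g (Btilde l erefl B N)
    = map_mx polyC (rowsub g (B^T *m invmx N)) *m power_mx l lb 'X.
  rewrite map_mxsub mul_rowsub_mx; congr (rowsub g _).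
  have -> : map_mx polyC (B^T *m invmx N)
      = \mxrow_i map_mx polyC (submxrow (B^T *m invmx N) i).
    by apply/mxrowP => i; rewrite mxrowK /submxrow map_mxsub.
  rewrite mul_mxrow_mxcol /Btilde; apply: eq_bigr => i _.
  rewrite /Bbar castmx_id [lpad l (submxrow _ _)]lpad_mul; last first.
    exact: lb_leq le_lb lb_last i.
  by rewrite map_mxM map_lpad1 scalemxAr.
rewrite -/Hp -eqH det_companion_block //; last first.
  move=> i j lt_ia; rewrite /submxblock -map_mxsub -/(submxblock L i j) Lup //.
  by case: eqP => _; rewrite ?map_lpad1 ?map_mx0.
by rewrite detG mulr1 BtE.
Qed.

End Yokoyama.

Theorem theorem7p3 (R : realType) (n r l a : nat)
    (A : 'M[R]_n) (B : 'M[R]_(n, r)) (C : 'M[R]_(l, n))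
    (lt_lr : (l < r)%N) (rankC : \rank C = l)
    (obsAC : observable A C) (idx_a : obsv_index A C a)
    (nrankP : normal_rank (sysmx A B C) = (n + l)%N)
    (N : 'M[R]_n) (M : 'M[R]_l)
    (yok : yokoyama_form (sum_lbar obsAC idx_a) A C N M)
    (phi psi : {poly R})
    (phiP : system_zero_poly A B C phi)
    (psiP : is_gcd_of
       (shifted_minor n a (Btilde l (sum_lbar obsAC idx_a) B N)) psi) :
  same_zeros phi psi.
Proof.
have le_ln : (l <= n)%N by rewrite -rankC rank_leq_col.
have lb_last (i : 'I_a) : i.+1 = a -> lbar A C i = l.
  by move/(lbar_last A C) ->.
have nz_detM : \det M != 0.
  by case: yok => _ /is_perm_mxP[s ->] _ _ _; rewrite det_perm signr_eq0.
have minorE g := yokoyama_minor (@leq_lbar _ _ _ A C a) lb_last le_ln B g yok.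
(* Multiplication by the constant det M carries the nonzero minors of P(s) to the shifted minors of
   B~. *)
apply/eqp_same_zeros/(is_gcd_of_eqp nz_detM _ phiP psiP) => u.
rewrite system_zero_minorE // bordered_minor_max /shifted_minor.
rewrite scaler_eq0 negb_or nz_detM /= -mul_polyC (mulrC _ u); split.
  move=> [[g incg ->] ->]; split=> //.
  exists (\det (rowsub g (Btilde l (sum_lbar obsAC idx_a) B N))).
    by apply/max_minorE; exists g.
  exact: minorE.
case=> nz_u [d /max_minorE[g incg ->]]; rewrite -minorE => eq_u; split=> //.
exists g => //.
(* Cancelling the power of s and then det M identifies [u] with the bordered minor for [g]. *)
have nzX : 'X^(l * a) != 0 :> {poly R} := monic_neq0 (monicXn _ _).
by apply: (mulIf _ (mulfI nzX eq_u)); rewrite polyC_eq0.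
Qed.
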